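(* For every $X\subseteq\mathrm{SENT}$ and every sentence $\varphi$ of $\mathcal L_{\mathrm{Tr}}$: $\#\varphi\in\mathcal J_{\mathrm{svi}_2}(X)\Leftrightarrow\#\varphi\in\mathcal J_{\mathrm{csv}}(X)$.
   Context: **Language.** $\mathcal L_{\mathbb N}$ is the language of Heyting arithmetic (logical symbols $\bot,\to,\vee,\wedge,\forall,\exists$; $\neg A$ is $A\to\bot$), with finitely many additional function symbols for primitive recursive functions. $\mathcal L_{\mathrm{Tr}}=\mathcal L_{\mathbb N}\cup\{\mathrm{Tr}\}$ with $\mathrm{Tr}$ a unary predicate. Fix a standard Gödel numbering; $\#\varphi$ is the code of $\varphi$, $\bar n$ the numeral of $n$, $t^{\mathbb N}$ the value of a closed term $t$ in the standard model. $\mathrm{SENT}\subseteq\omega$ is the set of codes of sentences of $\mathcal L_{\mathrm{Tr}}$. **Structures.** A *structure* (persistent first-order intuitionistic Kripke $\omega$-structure) is $\mathcal M=\langle W_{\mathcal M},\le_{\mathcal M},\mathcal D_{\mathcal M},\mathcal I_{\mathcal M}\rangle$ with $W_{\mathcal M}$ a set (of worlds), $\le_{\mathcal M}$ a partial order on it, $\mathcal D_{\mathcal M}$ assigning the domain $\omega$ to each world, and $\mathcal I_{\mathcal M}\subseteq W_{\mathcal M}\times\mathrm{SENT}$ such that $u\le_{\mathcal M}v$ and $\langle u,x\rangle\in\mathcal I_{\mathcal M}$ imply $\langle v,x\rangle\in\mathcal I_{\mathcal M}$. Write $\mathcal I_{\mathcal M}(w)=\{x:\langle w,x\rangle\in\mathcal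 I_{\mathcal M}\}$. **Global forcing** $w\Vdash_{\mathrm G,\mathcal M}A$ for sentences of $\mathcal L_{\mathrm{Tr}}$: $w\nVdash_{\mathrm G}\bot$; an atomic arithmetical sentence is forced iff true in $\mathbb N$; $w\Vdash_{\mathrm G}\mathrm{Tr}(s)$ iff $s^{\mathbb N}\in\mathcal I_{\mathcal M}(w)$; $w\Vdash_{\mathrm G}A\wedge B$ iff $w\Vdash_{\mathrm G}A$ and $w\Vdash_{\mathrm G}B$; $w\Vdash_{\mathrm G}A\vee B$ iff ($w'\Vdash_{\mathrm G}A$ for all $w'\ge w$) or ($w'\Vdash_{\mathrm G}B$ for all $w'\ge w$); $w\Vdash_{\mathrm G}A\to B$ iff for all $w'\ge w$, $w'\Vdash_{\mathrm G}A$ implies $w'\Vdash_{\mathrm G}B$; $w\Vdash_{\mathrm G}\exists xA$ iff for all $w'\ge w$ there is $n\in\omega$ with $w'\Vdash_{\mathrm G}A(\bar n)$; $w\Vdash_{\mathrm G}\forall xA$ iff $w\Vdash_{\mathrm G}A(\bar n)$ for all $n\in\omega$. **Embeddings.** $f:W_{\mathcal M}\to W_{\mathcal M'}$ is an embedding-interpretation function, written $\mathcal I_{\mathcal M}\leqq_f\mathcal I_{\mathcal M'}$, iff $f$ is injective, $w_0\le_{\mathcal M}w_1\Leftrightarrow f(w_0)\le_{\mathcal M'}f(w_1)$, and $\mathcal I_{\mathcal M}(w)\subseteq\mathcal I_{\mathcal M'}(f(w))$ for all $w$. **The scheme svi$_2$.** $w\Vdash^{\mathcal M}_{\mathrm{svi}_2}\varphi$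 iff for all structures $\mathcal M'$ and all $f$ with $\mathcal I_{\mathcal M}\leqq_f\mathcal I_{\mathcal M'}$, $f(w)\Vdash_{\mathrm G,\mathcal M'}\varphi$. $\mathcal J_{\mathrm{svi}_2}(X)=\{\#\varphi\in\mathrm{SENT}:\forall\mathcal M\,\forall w\in W_{\mathcal M}(\mathcal I_{\mathcal M}(w)=X\Rightarrow w\Vdash^{\mathcal M}_{\mathrm{svi}_2}\varphi)\}$. **Compositional supervaluation** $w\Vdash^{\mathcal M}_{\mathrm{csv}}\varphi$ (sentences $\varphi$): for atomic $\varphi$ (including $\bot$), iff $w\Vdash_{\mathrm G,\mathcal M}\varphi$; $\psi\vee\chi$: iff ($w'\Vdash^{\mathcal M}_{\mathrm{csv}}\psi$ for all $w'\ge w$) or ($w'\Vdash^{\mathcal M}_{\mathrm{csv}}\chi$ for all $w'\ge w$); $\psi\wedge\chi$: iff both are csv-forced at $w$; $\psi\to\chi$: iff for all structures $\mathcal M'$ and $f$ with $\mathcal I_{\mathcal M}\leqq_f\mathcal I_{\mathcal M'}$, $f(w)\Vdash_{\mathrm G,\mathcal M'}\psi\to\chi$; $\forall v\psi$: iff $w\Vdash^{\mathcal M}_{\mathrm{csv}}\psi(\bar n)$ for all $n\in\omega$; $\exists v\psi$: iff for all $w'\ge w$ there is $n\in\omega$ with $w'\Vdash^{\mathcal M}_{\mathrm{csv}}\psi(\bar n)$. $\mathcal J_{\mathrm{csv}}(X)=\{\#\varphi\in\mathrm{SENT}:\forall\mathcal M\,\forall w\in W_{\mathcal M}(\mathcal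 I_{\mathcal M}(w)=X\Rightarrow w\Vdash^{\mathcal M}_{\mathrm{csv}}\varphi)\}$. *)

(* Defs.v *)
From HB Require Import structures.
From mathcomp Require Import all_boot.
From mathcomp Require Import boolp classical_sets.

Set Implicit Arguments.
Unset Strict Implicit.
Unset Printing Implicit Defensive.

Local Open Scope classical_set_scope.

(* [primrec_ext] spares a use of function extensionality. *)
Inductive primrec : forall n : nat, (n.-tuple nat -> nat) -> Prop :=
| primrec_zero n : @primrec n (fun _ => 0)
| primrec_succ : @primrec 1 (fun v => (thead v).+1)
| primrec_proj n (i : 'I_n) : @primrec n (fun v => tnth v i)
| primrec_comp m n (h : m.-tuple nat -> nat) (g : 'I_m -> n.-tuple nat -> nat) :
    primrec h -> (forall i, primrec (g i)) ->
    @primrec n (fun v => h [tuple g i v | i < m])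
| primrec_rec n (g : n.-tuple nat -> nat) (h : n.+2.-tuple nat -> nat)
    (f : n.+1.-tuple nat -> nat) :
    primrec g -> primrec h ->
    (forall v : n.-tuple nat, f [tuple of 0 :: v] = g v) ->
    (forall k (v : n.-tuple nat),
        f [tuple of k.+1 :: v] = h [tuple of k :: f [tuple of k :: v] :: v]) ->
    primrec f
| primrec_ext n (f g : n.-tuple nat -> nat) : primrec f -> f =1 g -> primrec g.

(* The function symbols added to 0, S, + and * in the language of Heyting
   arithmetic. *)
Record signature := Signature {
  symbol : finType;
  arity : symbol -> nat;
  symbol_fun : forall s : symbol, (arity s).-tuple nat -> nat;
  symbol_primrec : forall s : symbol, primrec (@symbol_fun s)
}.

Inductive term (L : signature) : Type :=
| Var of nat
| Zero
| Succ of term L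
| Add of term L & term L
| Mul of term L & term L
| Fun (s : symbol L) of {ffun 'I_(arity s) -> term L}.

Inductive formula (L : signature) : Type :=
| Bot
| Eq of term L & term L
| Tr of term L
| And of formula L & formula L
| Or of formula L & formula L
| Imp of formula L & formula L
| All of nat & formula L
| Ex of nat & formula L.

Arguments Var {L}.
Arguments Zero {L}.
Arguments Fun {L}.
Arguments Bot {L}.

Section Syntax.
Variable L : signature.

Definition numeral (n : nat) : term L := iter n (@Succ L) Zero.

(* The value in the standard model. Only meaningful for closed terms: the value
   given to a variable is irrelevant. *)
Fixpoint term_value (t : term L) : nat :=
  match t with
  | Var _ => 0
  | Zero => 0
  | Succ t => (term_value t).+1
  | Add t u => term_value t + term_value u
  | Mul t u => term_value t * term_value u
  | Fun s a => symbol_fun [tuple term_value (a i) | i < arity s]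
  end.

Fixpoint occurs (x : nat) (t : term L) : bool :=
  match t with
  | Var y => y == x
  | Zero => false
  | Succ t => occurs x t
  | Add t u | Mul t u => occurs x t || occurs x u
  | Fun s a => [exists i, occurs x (a i)]
  end.

Fixpoint free_in (x : nat) (A : formula L) : bool :=
  match A with
  | Bot => false
  | Eq t u => occurs x t || occurs x u
  | Tr t => occurs x t
  | And A B | Or A B | Imp A B => free_in x A || free_in x B
  | All y A | Ex y A => (y != x) && free_in x A
  end.

Definition sentence (A : formula L) : Prop := forall x, ~~ free_in x A.

Fixpoint tsubst (x n : nat) (t : term L) : term L :=
  match t with
  | Var y => if y == x then numeral n else Var y
  | Zero => Zero
  | Succ t => Succ (tsubst x n t)
  | Add t u => Add (tsubst x n t) (tsubst x n u)
  | Mul t u => Mul (tsubst x n t) (tsubst x n u)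
  | Fun s a => Fun s [ffun i => tsubst x n (a i)]
  end.

(* The numeral of [n] for the free occurrences of [x]; numerals being closed,
   no capture can occur. *)
Fixpoint subst (x n : nat) (A : formula L) : formula L :=
  match A with
  | Bot => Bot
  | Eq t u => Eq (tsubst x n t) (tsubst x n u)
  | Tr t => Tr (tsubst x n t)
  | And A B => And (subst x n A) (subst x n B)
  | Or A B => Or (subst x n A) (subst x n B)
  | Imp A B => Imp (subst x n A) (subst x n B)
  | All y A => All y (if y == x then A else subst x n A)
  | Ex y A => Ex y (if y == x then A else subst x n A)
  end.

Fixpoint height (A : formula L) : nat :=
  match A with
  | Bot | Eq _ _ | Tr _ => 1
  | And A B | Or A B | Imp A B => (maxn (height A) (height B)).+1
  | All _ A | Ex _ A => (height A).+1
  end.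

Lemma height_subst x n A : height (subst x n A) = height A.
Proof.
by elim: A => //= [A -> B -> | A -> B -> | A -> B -> | y A IH | y A IH] //;
  case: (y == x); rewrite ?IH.
Qed.

End Syntax.

Section Structures.
Variables (L : signature) (gn : formula L -> nat).

(* [gn] is the Goedel numbering. All that is ever required of it is
   injectivity, which is a hypothesis where it is needed. *)
Definition SENT : set nat := [set x | exists2 A, sentence A & x = gn A].

(* Every world has domain omega: this is built into the quantifier clauses of
   the forcing relations. *)
Record structure := Structure {
  world : Type;
  wle : world -> world -> Prop;
  interp : world -> set nat;
  wle_refl : forall w, wle w w;
  wle_trans : forall u v w, wle u v -> wle v w -> wle u w;
  wle_antisym : forall u v, wle u v -> wle v u -> u = v;
  interp_SENT : forall w, interp w `<=` SENT;
  interp_persistent : forall u v, wle u v -> interp u `<=` interp v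
}.

Definition embedding (M M' : structure) (f : world M -> world M') : Prop :=
  [/\ injective f,
      forall u v, wle u v <-> wle (f u) (f v)
    & forall w, interp w `<=` interp (f w)].

(* In the quantifier clauses the recursive call is on a numerical instance of
   the body, which has the same height as the body but is not a subformula;
   hence the recursion on a bound [k] for the height. The intended clauses are
   the lemmas [forcesE] and [csvE] below. *)
Fixpoint forces_rec (M : structure) (k : nat) (w : world M) (A : formula L)
    : Prop :=
  if k isn't k.+1 then False else
  match A with
  | Bot => False
  | Eq t u => term_value t = term_value u
  | Tr t => interp w (term_value t)
  | And A B => forces_rec k w A /\ forces_rec k w B
  | Or A B => (forall w', wle w w' -> forces_rec k w' A) \/
              (forall w', wle w w' -> forces_rec k w' B)
  | Imp A B => forall w', wle w w' -> forces_rec k w' A -> forces_rec k w' B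
  | All x A => forall n, forces_rec k w (subst x n A)
  | Ex x A => forall w', wle w w' -> exists n, forces_rec k w' (subst x n A)
  end.

Definition forces (M : structure) (w : world M) (A : formula L) : Prop :=
  forces_rec (height A) w A.

Definition svi2 (M : structure) (w : world M) (A : formula L) : Prop :=
  forall (M' : structure) (f : world M -> world M'),
    embedding f -> forces (f w) A.

Fixpoint csv_rec (M : structure) (k : nat) (w : world M) (A : formula L)
    : Prop :=
  if k isn't k.+1 then False else
  match A with
  | Bot | Eq _ _ | Tr _ => forces w A
  | And A B => csv_rec k w A /\ csv_rec k w B
  | Or A B => (forall w', wle w w' -> csv_rec k w' A) \/
              (forall w', wle w w' -> csv_rec k w' B)
  | Imp A B => forall (M' : structure) (f : world M -> world M'),
                 embedding f -> forces (f w) (Imp A B)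
  | All x A => forall n, csv_rec k w (subst x n A)
  | Ex x A => forall w', wle w w' -> exists n, csv_rec k w' (subst x n A)
  end.

Definition csv (M : structure) (w : world M) (A : formula L) : Prop :=
  csv_rec (height A) w A.

Lemma forces_recE (M : structure) k (w : world M) A :
  height A <= k -> forces_rec k w A = forces w A.
Proof.
rewrite /forces; have [m] := ubnP (height A).
elim: m k w A => // m IH [|k] w A; first by case: A.
have E (v : world M) B l : height B < m -> height B <= l ->
    forces_rec l v B = forces_rec (height B) v B by move=> ? ?; apply: IH.
case: A => //= [A B|A B|A B|x A|x A]; rewrite !ltnS ?geq_max ?gtn_max.
- move=> /andP[Am Bm] /andP[Ak Bk].
  by rewrite !(E _ A) ?(E _ B) ?leq_maxl ?leq_maxr.
- move=> /andP[Am Bm] /andP[Ak Bk]; congr (_ \/ _);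
    apply: eq_forall => v; apply: eq_forall => _.
    by rewrite !(E _ A) ?leq_maxl.
  by rewrite !(E _ B) ?leq_maxr.
- move=> /andP[Am Bm] /andP[Ak Bk].
  apply: eq_forall => v; apply: eq_forall => _.
  by rewrite !(E _ A) ?(E _ B) ?leq_maxl ?leq_maxr.
- by move=> Am Ak; apply: eq_forall => n; rewrite !E ?height_subst.
- move=> Am Ak; apply: eq_forall => v; apply: eq_forall => _.
  by apply: eq_exists => n; rewrite !E ?height_subst.
Qed.

Lemma csv_recE (M : structure) k (w : world M) A :
  height A <= k -> csv_rec k w A = csv w A.
Proof.
rewrite /csv; have [m] := ubnP (height A).
elim: m k w A => // m IH [|k] w A; first by case: A.
have E (v : world M) B l : height B < m -> height B <= l ->
    csv_rec l v B = csv_rec (height B) v B by move=> ? ?; apply: IH.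
case: A => //= [A B|A B|x A|x A]; rewrite !ltnS ?geq_max ?gtn_max.
- move=> /andP[Am Bm] /andP[Ak Bk].
  by rewrite !(E _ A) ?(E _ B) ?leq_maxl ?leq_maxr.
- move=> /andP[Am Bm] /andP[Ak Bk]; congr (_ \/ _);
    apply: eq_forall => v; apply: eq_forall => _.
    by rewrite !(E _ A) ?leq_maxl.
  by rewrite !(E _ B) ?leq_maxr.
- by move=> Am Ak; apply: eq_forall => n; rewrite !E ?height_subst.
- move=> Am Ak; apply: eq_forall => v; apply: eq_forall => _.
  by apply: eq_exists => n; rewrite !E ?height_subst.
Qed.

Lemma forcesE (M : structure) (w : world M) (A : formula L) :
  forces w A =
  match A with
  | Bot => False
  | Eq t u => term_value t = term_value u
  | Tr t => interp w (term_value t)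
  | And A B => forces w A /\ forces w B
  | Or A B => (forall w', wle w w' -> forces w' A) \/
              (forall w', wle w w' -> forces w' B)
  | Imp A B => forall w', wle w w' -> forces w' A -> forces w' B
  | All x A => forall n, forces w (subst x n A)
  | Ex x A => forall w', wle w w' -> exists n, forces w' (subst x n A)
  end.
Proof.
rewrite {1}/forces; case: A => //= [A B|A B|A B|x A|x A].
- by rewrite !forces_recE ?leq_maxl ?leq_maxr.
- by congr (_ \/ _); apply: eq_forall => v; apply: eq_forall => _;
    rewrite forces_recE ?leq_maxl ?leq_maxr.
- by apply: eq_forall => v; apply: eq_forall => _;
    rewrite !forces_recE ?leq_maxl ?leq_maxr.
- by apply: eq_forall => n; rewrite forces_recE ?height_subst.
- apply: eq_forall => v; apply: eq_forall => _; apply: eq_exists => n.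
  by rewrite forces_recE ?height_subst.
Qed.

Lemma csvE (M : structure) (w : world M) (A : formula L) :
  csv w A =
  match A with
  | Bot | Eq _ _ | Tr _ => forces w A
  | And A B => csv w A /\ csv w B
  | Or A B => (forall w', wle w w' -> csv w' A) \/
              (forall w', wle w w' -> csv w' B)
  | Imp A B => forall (M' : structure) (f : world M -> world M'),
                 embedding f -> forces (f w) (Imp A B)
  | All x A => forall n, csv w (subst x n A)
  | Ex x A => forall w', wle w w' -> exists n, csv w' (subst x n A)
  end.
Proof.
rewrite {1}/csv; case: A => //= [A B|A B|x A|x A].
- by rewrite !csv_recE ?leq_maxl ?leq_maxr.
- by congr (_ \/ _); apply: eq_forall => v; apply: eq_forall => _;
    rewrite csv_recE ?leq_maxl ?leq_maxr.
- by apply: eq_forall => n; rewrite csv_recE ?height_subst.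
- apply: eq_forall => v; apply: eq_forall => _; apply: eq_exists => n.
  by rewrite csv_recE ?height_subst.
Qed.

Definition J_svi2 (X : set nat) : set nat :=
  [set x | exists A, [/\ sentence A, x = gn A
    & forall (M : structure) (w : world M), interp w = X -> svi2 w A]].

Definition J_csv (X : set nat) : set nat :=
  [set x | exists A, [/\ sentence A, x = gn A
    & forall (M : structure) (w : world M), interp w = X -> csv w A]].

End Structures.

(* Main.v *)
Require Import Defs.
From mathcomp Require Import all_boot.
From mathcomp Require Import boolp classical_sets.

Local Open Scope classical_set_scope.

(** The two forcing relations agree at every world of every structure, by
    induction on the formula. The clauses for disjunctions and existentials
    need amalgamation: if each [A i] fails at the image of [w] in some extension
    [f i : M -> N i], put all the [N i] side by side above [M], with [u] in [M]
    below [v] in [N i] iff [f i u <= v]. Each [N i] is upward closed in the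
    result, so by persistence every [A i] fails at [w] in this one extension. *)

Section Forcing.
Context {L : signature} {gn : formula L -> nat}.
Implicit Types M N : structure gn.

(** The quantifier clauses pass to [subst x n A], which has the height of [A] but need not be a
    subformula, so structural induction would give no hypothesis for it. *)
Lemma formula_height_ind (P : formula L -> Prop) :
  (forall A, (forall B, height B < height A -> P B) -> P A) -> forall A, P A.
Proof.
move=> IH A; have [m] := ubnP (height A).
elim: m A => // m IHm A Am; apply: IH => B BA.
exact/IHm/(leq_trans BA).
Qed.

Lemma forces_persistent M (u v : world M) A :
  wle u v -> forces u A -> forces v A.
Proof.
elim/formula_height_ind: A u v => A IH u v uv.
rewrite (forcesE u) (forcesE v); case: A IH => //= [t|A B|A B|A B|x A|x A] IH.
- exact: interp_persistent.
- by case=> uA uB; split; [move: uA|move: uB]; apply: IH; rewrite // ltnS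
    ?leq_maxl ?leq_maxr.
- by case=> H; [left|right] => w vw; apply: H; apply: wle_trans vw.
- by move=> H w vw; apply: H; apply: wle_trans vw.
- by move=> H n; apply: (IH _ _ u) => //; rewrite height_subst.
- by move=> H w vw; apply: H; apply: wle_trans vw.
Qed.

(** By persistence the disjuncts can be tested at [w] alone. *)
Lemma forces_Or M (w : world M) A B :
  forces w (Or A B) <-> forces w A \/ forces w B.
Proof.
rewrite (forcesE w (Or A B)); split.
  by case=> H; [left|right]; apply: H; apply: wle_refl.
by case=> H; [left|right] => v wv; apply: forces_persistent wv H.
Qed.

Lemma forces_Ex M (w : world M) x A :
  forces w (Ex x A) <-> exists n, forces w (subst x n A).
Proof.
rewrite (forcesE w (Ex x A)); split=> [|[n H] v wv].
  by apply; apply: wle_refl.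
by exists n; apply: forces_persistent wv H.
Qed.

(** The first two hypotheses make the worlds above [g u] exactly the images of the worlds above [u],
    so the clauses that look upwards agree. *)
Lemma forces_bounded_morphism M N (g : world M -> world N) :
  (forall u v, wle u v -> wle (g u) (g v)) ->
  (forall u v', wle (g u) v' -> exists2 v, wle u v & v' = g v) ->
  (forall u, interp (g u) = interp u) ->
  forall (u : world M) A, forces (g u) A <-> forces u A.
Proof.
move=> g_mono g_back g_interp u A.
elim/formula_height_ind: A u => A IH u.
rewrite (forcesE u) (forcesE (g u)); case: A IH => //= [t|A B|A B|A B|x A|x A] IH.
- by rewrite g_interp.
- by rewrite !IH // ltnS ?leq_maxl ?leq_maxr.
- have up C : height C < (maxn (height A) (height B)).+1 ->
      (forall w, wle (g u) w -> forces w C) <->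
      (forall v, wle u v -> forces v C).
    move=> hC; split=> [H v uv|H w]; first by apply/IH => //; apply/H/g_mono.
    by case/g_back=> v uv ->; apply/IH => //; apply: H.
  by rewrite !up // ltnS ?leq_maxl ?leq_maxr.
- split=> [H v uv vA|H w].
    apply/IH; first by rewrite ltnS leq_maxr.
    by apply: H; [apply: g_mono|apply/IH => //; rewrite ltnS leq_maxl].
  case/g_back=> v uv -> vA; apply/IH; first by rewrite ltnS leq_maxr.
  by apply: H => //; apply/IH => //; rewrite ltnS leq_maxl.
- by split=> H n; apply/IH => //; rewrite height_subst.
- split=> [H v uv|H w].
    have [n Hn] := H _ (g_mono _ _ uv).
    by exists n; apply/IH => //; rewrite height_subst.
  case/g_back=> v uv ->; have [n Hn] := H _ uv.
  by exists n; apply/IH => //; rewrite height_subst.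
Qed.

Lemma embedding_id M : embedding (fun w : world M => w).
Proof. by split=> // w. Qed.

Lemma svi2_forces M (w : world M) A : svi2 w A -> forces w A.
Proof. by move=> /(_ M _ (embedding_id M)). Qed.

Lemma svi2_persistent M (u v : world M) A : wle u v -> svi2 u A -> svi2 v A.
Proof.
move=> uv H N f f_emb; apply: forces_persistent (H N f f_emb).
by case: f_emb => _ <-.
Qed.

Section Amalgam.
Variables (I : Type) (M : structure gn) (N : I -> structure gn).
Variable f : forall i, world M -> world (N i).
Arguments f : clear implicits.
Hypothesis f_emb : forall i, embedding (f i).

Definition amalgam_world : Type := world M + {i : I & world (N i)}.

(** Worlds of [N i] and [N j] have different types, so they are compared after transport along a
    proof of [i = j]; copies with distinct indices are incomparable. *)
Definition amalgam_le (p q : amalgam_world) : Prop :=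
  match p, q with
  | inl u, inl v => wle u v
  | inl u, inr (existT i v) => wle (f i u) v
  | inr _, inl _ => False
  | inr (existT i u), inr (existT j v) =>
      exists e : i = j, wle (ecast k (world (N k)) e u) v
  end.

Definition amalgam_interp (p : amalgam_world) : set nat :=
  match p with
  | inl u => interp u
  | inr (existT i u) => interp u
  end.

Lemma amalgam_le_refl p : amalgam_le p p.
Proof.
case: p => [u|[i u]] /=; first exact: wle_refl.
by exists erefl; apply: wle_refl.
Qed.

Lemma amalgam_le_trans p q r :
  amalgam_le p q -> amalgam_le q r -> amalgam_le p r.
Proof.
case: p q r => [u|[i u]] [v|[j v]] [w|[k w]] //=.
- exact: wle_trans.
- by move=> uv; apply: wle_trans; have [_ <-] := f_emb k.
- by move=> uv [e]; subst k; apply: wle_trans.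
- move=> [e uv] [e' vw]; subst k; subst j.
  by exists erefl; apply: wle_trans vw.
Qed.

Lemma amalgam_le_antisym p q : amalgam_le p q -> amalgam_le q p -> p = q.
Proof.
case: p q => [u|[i u]] [v|[j v]] //=.
  by move=> uv vu; rewrite (wle_antisym uv vu).
move=> [e uv] [e' vu]; subst j.
(* Here [e'] has become a loop at [i]; proof irrelevance turns it into [erefl], which removes the
   transport in [vu]. *)
by rewrite (Prop_irrelevance e' erefl) /= in vu; rewrite (wle_antisym uv vu).
Qed.

Lemma amalgam_interp_SENT p : amalgam_interp p `<=` SENT gn.
Proof. by case: p => [u|[i u]]; apply: interp_SENT. Qed.

Lemma amalgam_interp_persistent p q :
  amalgam_le p q -> amalgam_interp p `<=` amalgam_interp q.
Proof.
case: p q => [u|[i u]] [v|[j v]] //=; first exact: interp_persistent.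
  move=> uv; have [_ _ f_interp] := f_emb j.
  exact: subset_trans (f_interp u) (interp_persistent uv).
by move=> [e]; subst j; apply: interp_persistent.
Qed.

Definition amalgam : structure gn :=
  Structure amalgam_le_refl amalgam_le_trans amalgam_le_antisym
    amalgam_interp_SENT amalgam_interp_persistent.

Lemma embedding_amalgam : embedding (inl : world M -> world amalgam).
Proof. by split=> [u v []|u v|w]. Qed.

(** Only worlds of the same copy lie above a world of [N i], so its inclusion satisfies the back
    condition of [forces_bounded_morphism]. *)
Lemma forces_amalgam i (u : world (N i)) A :
  forces (inr (existT _ i u) : world amalgam) A <-> forces u A.
Proof.
apply: (forces_bounded_morphism (N i) amalgam (fun v => inr (existT _ i v))).
- by move=> v w vw; exists erefl.
- move=> v [w|[j w]] //= [e]; subst j => vw; by exists w.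
- by [].
Qed.

End Amalgam.

Lemma svi2_common_failure I M (w : world M) (A : I -> formula L) :
  (forall i, ~ svi2 w (A i)) ->
  exists (N : structure gn) (f : world M -> world N),
    embedding f /\ forall i, ~ forces (f w) (A i).
Proof.
move=> noA.
(* Structure and map are packed into one dependent pair so that [choice] selects both at once. *)
have /choice[N_f fail] i :
    exists p : {N : structure gn & world M -> world N},
      embedding (projT2 p) /\ ~ forces (projT2 p w) (A i).
  apply: contrapT => H; apply: (noA i) => N f f_emb.
  by apply: contrapT => fA; apply: H; exists (existT _ N f).
pose f i := projT2 (N_f i).
have f_emb i : embedding (f i) by have [] := fail i.
exists (amalgam I M _ f f_emb), inl; split; first exact: embedding_amalgam.
move=> i wA; have [_] := fail i; apply.
apply/(forces_amalgam _ _ _ f f_emb i); apply: forces_persistent wA.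
(* The order from [inl w] to the copy of [f i w] unfolds to [wle (f i w) (f i w)]. *)
exact: wle_refl.
Qed.

(** If each disjunct fails in an extension of its own, an amalgam indexed by [bool] refutes both at
    the image of [w]. *)
Lemma svi2_Or M (w : world M) A B :
  svi2 w (Or A B) <-> svi2 w A \/ svi2 w B.
Proof.
split=> [H|H N f f_emb]; last first.
  by apply/forces_Or; case: H => H; [left|right]; apply: H.
apply: contrapT => /not_orP[noA noB].
have [|N [f [f_emb fail]]] :=
    svi2_common_failure _ M w (fun b : bool => if b then A else B).
  by case.
by have /forces_Or[] := H N f f_emb; [apply: (fail true)|apply: (fail false)].
Qed.

(** A priori the witness depends on the extension. An amalgam with one copy for each number refutes
    all instances at once, which forces a uniform witness. *)
Lemma svi2_Ex M (w : world M) x A :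
  svi2 w (Ex x A) <-> exists n, svi2 w (subst x n A).
Proof.
split=> [H|[n H] N f f_emb]; last by apply/forces_Ex; exists n; apply: H.
apply: contrapT => /forallNP noA.
have [N [f [f_emb fail]]] := svi2_common_failure _ M w _ noA.
by have /forces_Ex[n] := H N f f_emb; apply: fail.
Qed.

Lemma svi2_csv M (w : world M) A : svi2 w A <-> csv w A.
Proof.
elim/formula_height_ind: A w => A IH w; rewrite csvE.
case: A IH => [|t u|t|A B|A B|A B|x A|x A] IH.
- by split=> [/svi2_forces|]; rewrite ?forcesE.
- split=> [/svi2_forces //|]; rewrite forcesE => H N f _.
  by rewrite forcesE.
(* A true [Tr t] survives in every extension because embeddings only enlarge the interpretation. *)
- split=> [/svi2_forces //|]; rewrite forcesE => H N f [_ _ f_interp].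
  by rewrite forcesE; apply: f_interp.
- rewrite -!IH /= ?ltnS ?leq_maxl ?leq_maxr //; split=> [H|[wA wB] N f f_emb].
    by split=> N f f_emb; have := H N f f_emb; rewrite forcesE => -[].
  by rewrite forcesE; split; [apply: wA|apply: wB].
(* The [csv] clause looks at all worlds above [w]: it is used at [w] itself, and established by
   persistence of [svi2]. *)
- rewrite svi2_Or; split; last first.
    case=> H; [left|right]; (apply/IH; last exact/H/wle_refl);
      by rewrite /= ltnS ?leq_maxl ?leq_maxr.
  case=> H; [left|right] => v wv; (apply/IH; last exact: svi2_persistent wv H);
    by rewrite /= ltnS ?leq_maxl ?leq_maxr.
(* For an implication the [csv] clause is the definition of [svi2]. *)
- by [].
- split=> [H n|H N f f_emb].
    apply/IH; first by rewrite height_subst.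
    by move=> N f f_emb; have := H N f f_emb; rewrite forcesE.
  rewrite forcesE => n; have /IH := H n; apply=> //.
  by rewrite height_subst.
- rewrite svi2_Ex; split=> [[n H] v wv|H].
    exists n; apply/IH; first by rewrite height_subst.
    exact: svi2_persistent wv H.
  have [n Hn] := H w (wle_refl w); exists n.
  by apply/IH => //; rewrite height_subst.
Qed.

End Forcing.

Theorem proposition23 (L : signature) (gn : formula L -> nat)
    (gn_inj : injective gn) (X : set nat) (X_SENT : X `<=` SENT gn)
    (phi : formula L) (phi_sentence : sentence phi) :
  J_svi2 gn X (gn phi) <-> J_csv gn X (gn phi).
Proof.
by split=> -[A [A_sent phiA H]]; exists A; split=> // M w wX;
  apply/svi2_csv/H.
Qed.
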